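(* Let $\{\mu_n\}_{n=0}^\infty$ be a sequence of real numbers such that, for some $\epsilon>0$ and some $p\geqslant 2+\epsilon$, there is a constant $M>0$ with $$(n+1)^{p-1}\sum_{i=0}^n\left|\binom{n}{i}(-1)^{n-i}\Delta^{n-i}\mu_i\right|^p<M\qquad (n=0,1,2,\ldots).$$ Then for every $x>0$, $$g(x):=\sum_{n=0}^\infty\frac{(-1)^n}{n!}\mu_n x^n=\frac{\sqrt{2}}{x+1}\sum_{n=0}^\infty u_n\, i^n\left(\frac{x-1}{x+1}\right)^n,$$ where $$u_n=\sqrt{2}\sum_{k=0}^\infty\frac{(-1)^k}{k!}\,\mu_k\,P_n\!\left[-i\left(k+\tfrac12\right)\right].$$ The convergence of the expansion on the right-hand side is uniform on any compact subset of $(0,+\infty)$.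
   Context: $i$ in $i^n$ and in the argument of $P_n$ is the imaginary unit (in the displayed condition, $i$ is a summation index). $\Delta$ is the forward difference operator $\Delta\mu_n=\mu_{n+1}-\mu_n$, and $\Delta^k\mu_n=\sum_{m=0}^k(-1)^m\binom{k}{m}\mu_{n+k-m}$, with $\Delta^0$ the identity. $P_n=P_n^{(1/2)}$ are the Pollaczek polynomials with parameter $1/2$, defined by $P_{-1}(y)=0$, $P_0(y)=1$, $(n+1)P_{n+1}(y)-2yP_n(y)+nP_{n-1}(y)=0$ (equivalently $P_n(y)=i^n\,{}_2F_1(-n,\tfrac12+iy;1;2)$); they are evaluated at complex arguments as polynomials. Known background: for $p>1$, the displayed condition is equivalent to the existence of $u\in L^p[0,1]$ such that $\mu_n=\int_0^1 t^n u(t)\,dt$ for all $n\ge 0$ (Widder, The Laplace Transform). *)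

(* Defs.v *)
From HB Require Import structures.
From mathcomp Require Import all_boot all_order all_algebra.
From mathcomp Require Import all_classical all_reals all_analysis.
From mathcomp Require Import complex.
From mathcomp Require Import ring.

Set Implicit Arguments.
Unset Strict Implicit.
Unset Printing Implicit Defensive.

Import Order.TTheory GRing.Theory Num.Theory.
Import numFieldNormedType.Exports.

Local Open Scope ring_scope.

Definition fwd_diff (R : zmodType) (u : nat -> R) : nat -> R :=
  fun n => u n.+1 - u n.

Definition fwd_diffn (R : zmodType) (k : nat) (u : nat -> R) : nat -> R :=
  iter k (@fwd_diff R) u.

Lemma fwd_diffnE (R : comPzRingType) (u : nat -> R) k n :
  fwd_diffn k u n
  = \sum_(m < k.+1) (-1) ^+ m * 'C(k, m)%:R * u (n + k - m)%N.
Proof.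
elim: k n => [|k IHk] n; rewrite /fwd_diffn.
  by rewrite big_ord_recl big_ord0 /= bin0 addn0 subn0 !mul1r addr0.
rewrite iterS -/(fwd_diffn k u) /fwd_diff !IHk.
rewrite [RHS]big_ord_recl.
rewrite [in RHS](eq_bigr (fun m : 'I_k.+1 =>
    (-1) ^+ m.+1 * 'C(k, m.+1)%:R * u (n + k - m)%N
    - (-1) ^+ m * 'C(k, m)%:R * u (n + k - m)%N)); last first.
  move=> m _; rewrite lift0 binS natrD addnS subSS exprS.
  by rewrite mulrDr mulrDl !mulN1r !mulNr.
rewrite big_split sumrN addrA; congr (_ - _).
rewrite [in RHS]big_ord_recr /= (@bin_small k k.+1) // mulr0 mul0r addr0.
rewrite big_ord_recl !bin0 !subn0 addnS addSn; congr (_ + _).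
Qed.

(* The convention P_(-1) = 0 is built in: for n = 0 the recurrence
   (n + 1) P_(n+1) = 2 y P_n - n P_(n-1) reads P_1 = 2 y. *)
Fixpoint pollaczek (F : fieldType) (n : nat) : {poly F} :=
  match n with
  | 0 => 1
  | m.+1 =>
    match m with
    | 0 => 2 *: 'X
    | l.+1 => (m.+1)%:R^-1 *:
                (2 *: ('X * pollaczek F m) - m%:R *: pollaczek F l)
    end
  end.

Lemma pollaczek_rec (F : numFieldType) (n : nat) (y : F) :
  n.+2%:R * (pollaczek F n.+2).[y] - 2 * y * (pollaczek F n.+1).[y]
    + n.+1%:R * (pollaczek F n).[y] = 0.
Proof.
have -> : pollaczek F n.+2 = n.+2%:R^-1 *:
    (2 *: ('X * pollaczek F n.+1) - n.+1%:R *: pollaczek F n) by [].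
move: (pollaczek F n.+1) (pollaczek F n) => a b.
rewrite hornerZ hornerD hornerN !hornerZ hornerM hornerX.
rewrite mulVKf ?pnatr_eq0 //.
ring.
Qed.

(* R[i] itself carries no topology; limits are taken in R[i]^o, whose topology
   is the one of the complex modulus. *)
Section expansion.
Local Open Scope classical_set_scope.
Local Open Scope complex_scope.
Variables (R : realType) (mu : nat -> R).

Definition g_term (x : R) (n : nat) : R :=
  (-1) ^+ n / n`!%:R * mu n * x ^+ n.

Definition g_fun (x : R) : R := limn (series (g_term x)).

Definition u_term (n k : nat) : R[i]^o :=
  ((-1) ^+ k / k`!%:R * mu k)%:C
    * (pollaczek R[i] n).[- 'i%C * (k%:R + 2^-1)].

Definition u_coef (n : nat) : R[i] :=
  (Num.sqrt 2)%:C * limn (series (u_term n)).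

Definition expansion_term (x : R) (n : nat) : R[i]^o :=
  u_coef n * 'i%C ^+ n * ((x - 1) / (x + 1))%:C ^+ n.

Definition expansion_psum (N : nat) (x : R) : R[i]^o :=
  (Num.sqrt 2 / (x + 1))%:C * series (expansion_term x) N.

Definition expansion (x : R) : R[i]^o :=
  (Num.sqrt 2 / (x + 1))%:C * limn (series (expansion_term x)).

End expansion.

(* Main.v *)
Require Import Defs.
From HB Require Import structures.
From mathcomp Require Import all_boot all_order all_algebra.
From mathcomp Require Import all_classical all_reals all_analysis.
From mathcomp Require Import complex.
From mathcomp Require Import zify ring lra.

Set Implicit Arguments.
Unset Strict Implicit.
Unset Printing Implicit Defensive.

Import Order.TTheory GRing.Theory Num.Theory.
Import numFieldNormedType.Exports.

(** Evaluated at [-i (k + 1/2)], the Pollaczek polynomials are Delannoy numbers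
    up to a power of [i]:  [i^n P_n(-i (k + 1/2)) = D(k, n)],  where
    [\sum_n D(k, n) z^n = (1 + z)^k / (1 - z)^(k+1)].  The Cayley transform
    [z = (x - 1) / (x + 1)] maps the half-line [x > 0] into [|z| < 1], and there
    this generating function equals [(x + 1) / 2 * x^k].  So, up to the factor
    [2 / (x + 1)], the expansion to be proved is obtained from
    [g(x) = \sum_k (-1)^k / k! mu_k x^k] by expanding each [x^k] in powers of
    [z] and exchanging the two summations; it is the Taylor expansion at [z = 0]
    of a function that is analytic in the unit disk.

    The exchange is made quantitative rather than deduced from a Fubini theorem.
    Delannoy numbers are nonnegative, so for [|z| <= q rho], with [q <= 1] and
    [rho < 1], the [N]-th remainder of the generating function at [z] is at most
    [q^(N+1)] times its remainder at [rho] ([ler_delannoy_tail]), hence at most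
    [q^(N+1) (1 + rho)^k / (1 - rho)^(k+1)].  As [mu] is bounded
    ([moment_condition_bounded]), summing against [(-1)^k / k! mu_k] leaves a
    constant multiple of [q^(N+1) exp((1 + rho) / (1 - rho))]
    ([g_expansion_remainder]): geometric decay, uniform in [|z| <= r] for each
    [r < 1].  This gives the pointwise and the uniform statements at once, since
    the Cayley transform maps a compact subset of the half-line into such a disk
    ([compact_cayley_le]). *)

Local Open Scope classical_set_scope.
Local Open Scope ring_scope.
Local Open Scope complex_scope.

(** * Delannoy numbers *)

(** The Delannoy number [D(k, n)] counts the lattice paths from (0, 0) to (k, n)
    with steps (1, 0), (0, 1) and (1, 1). *)
Fixpoint delannoy (k : nat) : nat -> nat :=
  if k is k'.+1 then
    fix row n := if n is n'.+1 then
                   (row n' + delannoy k' n'.+1 + delannoy k' n')%N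
                 else 1
  else fun=> 1.

Lemma delannoy0r k : delannoy k 0 = 1.
Proof. by case: k. Qed.

Lemma delannoySS k n :
  delannoy k.+1 n.+1
  = (delannoy k.+1 n + delannoy k n.+1 + delannoy k n)%N.
Proof. by []. Qed.

Lemma delannoy1r k : delannoy k 1 = k.*2.+1.
Proof. by elim: k => // k IH; rewrite delannoySS !delannoy0r IH; lia. Qed.

(** The Pollaczek recurrence at [-i (k + 1/2)].  On generating functions it is
    the equation [(1 - z^2) F' = (2 k + 1 + z) F] satisfied by
    [F = (1 + z)^k / (1 - z)^(k+1)].  In the induction on [k], the defects [T_k]
    of the recurrence satisfy [T_(k+1)(n+1) = T_(k+1)(n) + T_k(n+1) + T_k(n)],
    which is linear once the entries of row [k + 1] are expanded. *)
Lemma delannoy_rec k n :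
  (n.+2 * delannoy k n.+2
   = k.*2.+1 * delannoy k n.+1 + n.+1 * delannoy k n)%N.
Proof.
elim: k n => [|k IHk] n; first by rewrite /=; lia.
have rec0 m := delannoySS k m.
elim: n => [|n IHn].
  have := IHk 0; rewrite !rec0 !delannoy1r !delannoy0r -!muln2.
  by move: (delannoy k 2) => d; nia.
move: IHn (IHk n) (IHk n.+1); rewrite (rec0 n.+2) (rec0 n.+1) (rec0 n); lia.
Qed.

(** * Remainders of the Delannoy generating function *)

Section generating_function.
Variable R : realType.
Implicit Types z q rho : R.

Definition delannoy_gf k z : R := (1 + z) ^+ k / (1 - z) ^+ k.+1.

Definition delannoy_psum k N z : R :=
  \sum_(n < N) (delannoy k n)%:R * z ^+ n.

Lemma delannoy_gf0 z : delannoy_gf 0 z = (1 - z)^-1.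
Proof. by rewrite /delannoy_gf expr0 expr1 mul1r. Qed.

Lemma delannoy_gfS k z :
  delannoy_gf k.+1 z = (1 + z) / (1 - z) * delannoy_gf k z.
Proof. by rewrite /delannoy_gf mulf_div -!exprS. Qed.

(** The truncation of the identity [(1 - z) F_(k+1) = (1 + z) F_k]; the boundary
    term has the sign that makes all remainders nonnegative for [0 <= z < 1]. *)
Lemma delannoy_psumS k N z : (1 - z) * delannoy_psum k.+1 N.+1 z
  = (1 + z) * delannoy_psum k N.+1 z
    - z ^+ N.+1 * (delannoy k.+1 N + delannoy k N)%:R.
Proof.
rewrite /delannoy_psum; elim: N => [|N IHN].
  by rewrite !big_ord1 !delannoy0r !natrD; ring.
rewrite big_ord_recr [in RHS]big_ord_recr /= !mulrDr IHN.
by rewrite -/(delannoy k.+1) -/(delannoy k.+1 N.+1) delannoySS !natrD !exprS;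
  ring.
Qed.

(** This is [\sum_(n > N) D(k, n) z^n], defined as a difference so that its
    estimates, proved by induction on [k], presuppose no convergence. *)
Definition delannoy_tail k N z : R := delannoy_gf k z - delannoy_psum k N.+1 z.

Lemma delannoy_tail0 N z : z != 1 -> delannoy_tail 0 N z = z ^+ N.+1 / (1 - z).
Proof.
move=> z1; have z1' : 1 - z != 0 by rewrite subr_eq0 eq_sym.
rewrite /delannoy_tail /delannoy_psum delannoy_gf0; apply: (mulIf z1').
rewrite mulrBl mulVf // mulfVK //.
under eq_bigr do rewrite mul1r.
by apply/eqP; rewrite subr_eq addrC -subr_eq -opprB subrX1; apply/eqP; ring.
Qed.

Lemma delannoy_tailS k N z : z != 1 -> delannoy_tail k.+1 N z
  = ((1 + z) * delannoy_tail k N z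
     + z ^+ N.+1 * (delannoy k.+1 N + delannoy k N)%:R) / (1 - z).
Proof.
move=> z1; have z1' : 1 - z != 0 by rewrite subr_eq0 eq_sym.
apply: (mulIf z1'); rewrite mulfVK // /delannoy_tail mulrBl.
rewrite [delannoy_psum _.+1 _ _ * _]mulrC delannoy_psumS.
by rewrite delannoy_gfS; field.
Qed.

Lemma delannoy_tail_ge0 k N rho : 0 <= rho < 1 -> 0 <= delannoy_tail k N rho.
Proof.
case/andP=> r0 r1; have rN1 := lt_eqF r1.
elim: k => [|k IHk].
  by rewrite delannoy_tail0 ?rN1// divr_ge0 ?exprn_ge0// subr_ge0 ltW.
rewrite delannoy_tailS ?rN1// divr_ge0 ?subr_ge0 ?(ltW r1)//.
by rewrite addr_ge0 // mulr_ge0 // ?exprn_ge0 // addr_ge0.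
Qed.

(** For a power series with nonnegative coefficients, a tail starting at degree
    [N + 1] gains a factor [q^(N+1)] when its argument shrinks by [q].  For
    [z] in [[0, 1[] the coefficients of the recurrence [delannoy_tailS] are
    nonnegative and increasing, and at any [z] with [|z| < 1] they are dominated
    by their values at [|z|], so the bound passes from [k] to [k + 1]. *)
Lemma ler_delannoy_tail k N q rho z : 0 <= q <= 1 -> 0 <= rho < 1 ->
  `|z| <= q * rho ->
  `|delannoy_tail k N z| <= q ^+ N.+1 * delannoy_tail k N rho.
Proof.
move=> /andP[q0 q1] /andP[r0 r1] zqr.
have zr : `|z| <= rho by apply: le_trans zqr _; rewrite ler_piMl.
have zlt1 : z < 1 by apply: le_lt_trans r1; apply: le_trans zr; exact: ler_norm.
have zX : `|z| ^+ N.+1 <= q ^+ N.+1 * rho ^+ N.+1.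
  by rewrite -exprMn lerXn2r ?nnegrE // mulr_ge0.
have inv_le : `|(1 - z)^-1| <= (1 - rho)^-1.
  rewrite ger0_norm ?invr_ge0 ?subr_ge0 ?(ltW zlt1) //.
  by rewrite lef_pV2 ?posrE ?subr_gt0 // lerB // (le_trans (ler_norm _)).
have zN1 := lt_eqF zlt1; have rN1 := lt_eqF r1.
elim: k => [|k IHk].
  by rewrite !delannoy_tail0 ?zN1 ?rN1// normrM normrX mulrA ler_pM.
rewrite !delannoy_tailS ?zN1 ?rN1// normrM [leRHS]mulrA ler_pM //.
rewrite (le_trans (ler_normD _ _)) // [leRHS]mulrDr lerD //.
  rewrite normrM mulrCA ler_pM // (le_trans (ler_normD _ _)) // normr1.
  by rewrite lerD2l.
by rewrite normrM normrX normr_nat mulrA ler_wpM2r.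
Qed.

(** Cauchy's estimate for the Taylor coefficients. *)
Lemma ler_delannoy_gf k n rho : 0 <= rho < 1 ->
  (delannoy k n)%:R * rho ^+ n <= delannoy_gf k rho.
Proof.
move=> r01; have /andP[r0 _] := r01; have := delannoy_tail_ge0 k n r01.
rewrite subr_ge0 => /(le_trans _); apply.
by rewrite /delannoy_psum big_ord_recr /= lerDr sumr_ge0 // => i _;
  rewrite mulr_ge0 ?exprn_ge0.
Qed.

Lemma delannoy_tail_le_gf k N rho : 0 <= rho ->
  delannoy_tail k N rho <= delannoy_gf k rho.
Proof.
by move=> r0; rewrite gerBl sumr_ge0 // => i _; rewrite mulr_ge0 ?exprn_ge0.
Qed.

End generating_function.

(** Both sides obey the same three-term recurrence, because [(-i)^2 = -1] turns
    the minus sign of the Pollaczek recurrence into the plus sign of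
    [delannoy_rec]. *)
Lemma pollaczek_delannoy (R : realType) n k :
  (pollaczek R[i] n).[- 'i%C * (k%:R + 2^-1)]
  = (- 'i%C) ^+ n * (delannoy k n)%:R.
Proof.
suff: (pollaczek R[i] n).[- 'i%C * (k%:R + 2^-1)]
    = (- 'i%C) ^+ n * (delannoy k n)%:R
  /\ (pollaczek R[i] n.+1).[- 'i%C * (k%:R + 2^-1)]
    = (- 'i%C) ^+ n.+1 * (delannoy k n.+1)%:R by case.
elim: n => [|n [IH0 IH1]].
  rewrite hornerC expr0 delannoy0r mul1r; split=> //.
  rewrite delannoy1r hornerZ hornerX expr1 -muln2 -[(k * 2).+1]addn1.
  rewrite natrD natrM.
  by field.
split=> //.
set y := - 'i%C * (k%:R + 2^-1).
have : n.+2%:R * (pollaczek R[i] n.+2).[y] - 2 * y * (pollaczek R[i] n.+1).[y]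
    + n.+1%:R * (pollaczek R[i] n).[y] = 0 := pollaczek_rec n y.
rewrite IH0 IH1 {}/y; move: (pollaczek R[i] n.+2).[_] => P2 rec.
have := congr1 (fun m => m%:R : R[i]) (delannoy_rec k n).
rewrite natrM natrD !natrM -muln2 -[(k * 2).+1]addn1 natrD natrM => drec.
have n2 : n.+2%:R != 0 :> R[i] by rewrite pnatr_eq0.
have i2 : (- 'i%C) * (- 'i%C) = -1 :> R[i] by rewrite mulrNN -expr2 sqr_i.
apply: (mulfI n2); apply/eqP; rewrite -subr_eq0 -[X in _ == X]rec; apply/eqP.
rewrite mulrCA drec !exprS mulrA i2.
(* [i] is an atom for [ring]: its two occurrences are brought together here. *)
have -> : 2 * (- 'i%C * (k%:R + 2^-1))
      * (- 'i%C * (- 'i%C) ^+ n * (delannoy k n.+1)%:R)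
    = (- 'i%C) * (- 'i%C)
      * ((k%:R * 2 + 1) * ((- 'i%C) ^+ n * (delannoy k n.+1)%:R)) :> R[i].
  by field.
by rewrite i2; ring.
Qed.

(** * Real series in the complex plane *)

Section real_series_in_complex.
Variable R : realType.

Lemma normc_real (x : R) : `|x%:C| = `|x|%:C :> R[i].
Proof. by rewrite normc_def /= expr0n addr0 sqrtr_sqr. Qed.

Lemma cvg_real_complex (u : nat -> R) (l : R) :
  u @ \oo --> l -> (fun n => (u n)%:C : R[i]^o) @ \oo --> (l%:C : R[i]^o).
Proof.
move=> ul; apply/cvgrPdist_lt => e e0.
have eR : e = (complex.Re e)%:C by rewrite RRe_real // gtr0_real.
have Re0 : 0 < complex.Re e by rewrite -ltcR -eR.
near=> n.
rewrite -rmorphB normc_real eR ltcR.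
by near: n; apply: (cvgrPdist_lt _ _).1.
Unshelve. all: by end_near. Qed.

Lemma series_real_complex (a : nat -> R) (c : R[i]^o) :
  series (fun n => c * (a n)%:C : R[i]^o) = (fun n => c * (series a n)%:C).
Proof.
by apply/funext => n; rewrite /series /= rmorph_sum mulr_sumr.
Qed.

Lemma cvg_series_real_complex (a : nat -> R) (c : R[i]^o) (l : R) :
  series a @ \oo --> l ->
  series (fun n => c * (a n)%:C : R[i]^o) @ \oo --> (c * l%:C : R[i]^o).
Proof.
move=> al; rewrite series_real_complex.
by apply: cvgM; [exact: cvg_cst|exact: cvg_real_complex].
Qed.

(** Every series in [k] below is compared with an exponential series: for
    bounded [mu], the weights [mu_k / k!] absorb any geometric growth in [k]. *)
Lemma series_dominated_exp (a : R^nat) (C y : R) :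
  (forall k, `|a k| <= C * exp_coeff y k) ->
  cvgn (series a) /\ `|limn (series a)| <= C * expR y.
Proof.
move=> aC.
have eC : cvgn (series (C *: exp_coeff y)).
  by apply: is_cvg_seriesZ; exact: is_cvg_series_exp_coeff.
have na : cvgn [normed series a].
  apply: series_le_cvg eC => n; last exact: aC.
    exact: normr_ge0.
  exact: le_trans (aC n).
split; first exact: normed_cvg.
apply: le_trans (lim_series_norm na) _.
have -> : C * expR y = limn (series (C *: exp_coeff y)).
  by rewrite lim_seriesZ //; exact: is_cvg_series_exp_coeff.
exact: lim_series_le.
Qed.

End real_series_in_complex.

(** * Expansion of g in powers of the Cayley transform *)

Definition cayley (R : realType) (x : R) : R := (x - 1) / (x + 1).

(** With [z = (x - 1) / (x + 1)] one has [1 - z = 2 / (x + 1)] and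
    [(1 + z) / (1 - z) = x]: the monomials of [g] are generating functions. *)
Lemma delannoy_gf_cayley (R : realType) k (x : R) : 0 < x ->
  delannoy_gf k (cayley x) = (x + 1) / 2 * x ^+ k.
Proof.
move=> x0; rewrite /delannoy_gf /cayley.
have x1 : x + 1 != 0 by rewrite gt_eqF // addr_gt0.
rewrite exprSr invfM mulrA -expr_div_n mulrC.
have -> : 1 - (x - 1) / (x + 1) = 2 / (x + 1) by field.
have -> : 1 + (x - 1) / (x + 1) = 2 * x / (x + 1) by field.
rewrite invf_div; by congr (_ * _ ^+ _); field.
Qed.

Section expansion_of_g.
Variables (R : realType) (mu : nat -> R) (B : R).
Hypothesis mu_le : forall k, `|mu k| <= B.

Let B0 : 0 <= B. Proof. exact: le_trans (mu_le 0). Qed.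

Let c (k : nat) : R := (-1) ^+ k / k`!%:R * mu k.

Let ler_c k (d C y : R) :
  `|d| <= C * y ^+ k -> `|c k * d| <= (B * C) * exp_coeff y k.
Proof.
move=> dC; rewrite exp_coeffE normrM /c normrM normrM normrX normrN1 expr1n.
rewrite mul1r ger0_norm ?invr_ge0 //.
rewrite [leRHS](_ : _ = k`!%:R^-1 * B * (C * y ^+ k)); last by ring.
by apply: ler_pM => //; rewrite ?mulr_ge0 ?invr_ge0 // ler_wpM2l ?invr_ge0.
Qed.

(** Equal to [u_n i^n / sqrt 2]; unlike [u_n], it is real for every [n]. *)
Definition delannoy_coef n : R :=
  limn (series (fun k => c k * (delannoy k n)%:R)).

Lemma is_cvg_delannoy_coef n : cvgn (series (fun k => c k * (delannoy k n)%:R)).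
Proof.
apply: (series_dominated_exp (C := B * (2 ^+ n.+1)) (y := 3) _).1 => k.
apply: ler_c; rewrite normr_nat.
(* The 3 is (1 + rho) / (1 - rho) at rho = 1/2, one radius among many. *)
have := @ler_delannoy_gf R k n 2^-1 ltac:(lra).
rewrite exprVn ler_pdivrMr ?exprn_gt0 // => /le_trans; apply.
rewrite /delannoy_gf exprSr invfM mulrA -expr_div_n.
rewrite [X in X ^+ k](_ : _ = 3); last by field.
rewrite [X in _ * X * _](_ : _ = 2); last by field.
by rewrite exprSr; lra.
Qed.

Lemma is_cvg_g_term x : cvgn (series (g_term mu x)).
Proof.
apply: (series_dominated_exp (C := B * 1) (y := `|x|) _).1 => k.
by apply: ler_c; rewrite mul1r normrX.
Qed.

(** Termwise in [k], the difference between [g(x)] and a partial sum of its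
    expansion is [(-1)^k / k! mu_k] times a remainder of the [k]-th generating
    function.  Only finitely many limits in [k] are combined, so no double limit
    has to be exchanged. *)
Lemma g_expansion_remainder x q rho N : 0 < x -> 0 <= q <= 1 -> 0 <= rho < 1 ->
  `|cayley x| <= q * rho ->
  `|g_fun mu x
    - 2 / (x + 1) * series (fun n => delannoy_coef n * cayley x ^+ n) N.+1|
   <= q ^+ N.+1 * (2 * B / (1 - rho) * expR ((1 + rho) / (1 - rho))).
Proof.
move=> x0 q01 r01 zqr; have /andP[r0 r1] := r01.
pose a k := c k * delannoy_tail k N (cayley x).
have [cva lima] : cvgn (series a) /\ `|limn (series a)| <=
    B * (q ^+ N.+1 / (1 - rho)) * expR ((1 + rho) / (1 - rho)).
  apply: series_dominated_exp => k; apply: ler_c.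
  apply: le_trans (ler_delannoy_tail k N q01 r01 zqr) _.
  rewrite -mulrA ler_wpM2l ?exprn_ge0 //; first by case/andP: q01.
  apply: le_trans (delannoy_tail_le_gf k N r0) _.
  by rewrite /delannoy_gf exprS invfM mulrCA -expr_div_n.
have x1 : 0 < x + 1 by rewrite addr_gt0.
suff -> : g_fun mu x
    - 2 / (x + 1) * series (fun n => delannoy_coef n * cayley x ^+ n) N.+1
    = 2 / (x + 1) * limn (series a).
  rewrite normrM ger0_norm; last by rewrite divr_ge0 // ltW.
  have -> : q ^+ N.+1 * (2 * B / (1 - rho) * expR ((1 + rho) / (1 - rho)))
    = 2 * (B * (q ^+ N.+1 / (1 - rho)) * expR ((1 + rho) / (1 - rho))) by ring.
  apply: ler_pM => //; first by rewrite divr_ge0 // ltW.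
  by rewrite ler_pdivrMr //; lra.
suff cvg_a : series a @ \oo --> (x + 1) / 2 * g_fun mu x
     - series (fun n => delannoy_coef n * cayley x ^+ n) N.+1.
  by rewrite (cvg_lim _ cvg_a) //; field; rewrite gt_eqF.
have -> : series a = (fun K => (x + 1) / 2 * series (g_term mu x) K
    - \sum_(n < N.+1)
        series (fun k => c k * (delannoy k n)%:R) K * cayley x ^+ n).
  apply/funext => K; rewrite /series /= mulr_sumr.
  under [X in _ - X]eq_bigr do rewrite mulr_suml.
  rewrite exchange_big -sumrB; apply: eq_bigr => k _.
  rewrite /a /delannoy_tail delannoy_gf_cayley // mulrBr /delannoy_psum.
  rewrite mulr_sumr.
  congr (_ - _); first by rewrite /g_term -/(c k); ring.
  by apply: eq_bigr => n _; rewrite mulrA.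
apply: cvgB; first by apply: cvgM; [exact: cvg_cst|exact: is_cvg_g_term].
rewrite /series /= big_mkord.
apply: cvg_big; [exact: add_continuous|move=> n _].
by apply: cvgM; [exact: is_cvg_delannoy_coef|exact: cvg_cst].
Qed.

End expansion_of_g.

Section cayley_transform.
Variable R : realType.

Lemma cayley_norm_lt1 (x : R) : 0 < x -> `|cayley x| < 1.
Proof.
move=> x0; have x1 : 0 < x + 1 by rewrite addr_gt0.
rewrite /cayley ltr_norml ltr_pdivlMr // ltr_pdivrMr //; lra.
Qed.

(** The largest value of [|cayley x|] over the compact set is attained at a
    positive point, so it is smaller than 1. *)
Lemma compact_cayley_le (K : set R) : compact K -> K `<=` [set x | 0 < x] ->
  exists2 r, 0 <= r < 1 & forall x, K x -> `|cayley x| <= r.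
Proof.
move=> cK K0; have [->|K_neq0] := eqVneq K set0.
  by exists 0; rewrite ?lexx ?ltr01.
have cont : {within K, continuous (fun x => `|cayley x|)}.
  apply: continuous_in_subspaceT => x /set_mem /K0 /= x0.
  apply: cvg_norm; apply: cvgM.
    by apply: cvgB; [exact: cvg_id|exact: cvg_cst].
  apply: cvgV; first by rewrite gt_eqF // addr_gt0.
  by apply: cvgD; [exact: cvg_id|exact: cvg_cst].
have [x Kx xmax] := compact_EVT_max ((set0P _).1 K_neq0) cK cont.
exists `|cayley x|; last by move=> y Ky; apply: xmax; exact: mem_set.
by rewrite normr_ge0 cayley_norm_lt1 //; apply: K0; exact: set_mem.
Qed.

End cayley_transform.

(** * Identification with the Pollaczek expansion *)

Section pollaczek_expansion.
Variables (R : realType) (mu : nat -> R) (B : R).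
Hypothesis mu_le : forall k, `|mu k| <= B.

Let g_psum (x : R) N :=
  2 / (x + 1) * series (fun n => delannoy_coef mu n * cayley x ^+ n) N.

Lemma g_expansion_uniform r e : 0 <= r < 1 -> 0 < e ->
  \forall N \near \oo, forall x, 0 < x -> `|cayley x| <= r ->
    `|g_fun mu x - g_psum x N| < e.
Proof.
move=> /andP[r0 r1] e0.
(* [rho] is any radius strictly between [r] and 1, and [q = r / rho]. *)
pose rho := (1 + r) / 2; pose q := 2 * r / (1 + r).
have r10 : 0 < 1 + r by lra.
have rho01 : 0 <= rho < 1 by rewrite /rho; lra.
have q0 : 0 <= q by rewrite divr_ge0; lra.
have q1 : q < 1 by rewrite ltr_pdivrMr //; lra.
have qrho : q * rho = r by rewrite /q /rho; field; rewrite gt_eqF.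
pose C := 2 * B / (1 - rho) * expR ((1 + rho) / (1 - rho)).
have : geometric C q @ \oo --> 0 by apply: cvg_geometric; rewrite ger0_norm.
move=> /cvgrPdist_lt /(_ _ e0) Ce.
near=> N => x x0 xr.
have N0 : (0 < N)%N by near: N; exact: nbhs_infty_gt.
apply: (@le_lt_trans _ _ (C * q ^+ N)); last first.
  apply: le_lt_trans (ler_norm _) _.
  by rewrite -normrN -sub0r; near: N.
rewrite -(prednK N0) mulrC.
apply: g_expansion_remainder => //; last by rewrite qrho.
by rewrite q0 ltW.
Unshelve. all: by end_near. Qed.

Lemma cvg_g_expansion x : 0 < x -> g_psum x @ \oo --> g_fun mu x.
Proof.
move=> x0; apply/cvgrPdist_lt => e e0.
have x01 : 0 <= `|cayley x| < 1 by rewrite normr_ge0 cayley_norm_lt1.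
by apply: filterS (g_expansion_uniform x01 e0) => N; apply.
Qed.

Lemma cvg_u_term n :
  series (u_term mu n) @ \oo -->
    ((- 'i%C) ^+ n * (delannoy_coef mu n)%:C : R[i]^o).
Proof.
have -> : u_term mu n = fun k => (- 'i%C) ^+ n
    * ((-1) ^+ k / k`!%:R * mu k * (delannoy k n)%:R)%:C.
  apply/funext => k; rewrite /u_term pollaczek_delannoy mulrCA.
  by rewrite [in RHS]rmorphM rmorph_nat.
exact/cvg_series_real_complex/(is_cvg_delannoy_coef mu_le).
Qed.

(** The factor [i^n] of the expansion cancels the [(-i)^n] of [cvg_u_term]. *)
Lemma expansion_termE x : expansion_term mu x
  = fun n => (Num.sqrt 2)%:C * (delannoy_coef mu n * cayley x ^+ n)%:C.
Proof.
apply/funext => n.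
rewrite /expansion_term /u_coef (cvg_lim _ (cvg_u_term (n := n))) //.
have i1 : (- 'i%C) ^+ n * 'i%C ^+ n = 1 :> R[i].
  by rewrite -exprMn mulNr -expr2 sqr_i opprK expr1n.
by rewrite -/(cayley x) [in RHS]rmorphM [in RHS]rmorphXn -[RHS]mul1r -i1; ring.
Qed.

Let sqrt2_sqr : Num.sqrt 2 * Num.sqrt 2 = 2 :> R.
Proof. by rewrite -expr2 sqr_sqrtr. Qed.

Lemma expansion_psumE x N : expansion_psum mu N x = (g_psum x N)%:C.
Proof.
rewrite /expansion_psum expansion_termE series_real_complex -!rmorphM.
congr _%:C.
by rewrite /g_psum -[in RHS]sqrt2_sqr; ring.
Qed.

Lemma is_cvg_expansion_term x : 0 < x -> cvgn (series (expansion_term mu x)).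
Proof.
move=> x0; have x1 : x + 1 != 0 by rewrite gt_eqF // addr_gt0.
rewrite expansion_termE; apply/cvg_ex; eexists; apply: cvg_series_real_complex.
have -> : series (fun n => delannoy_coef mu n * cayley x ^+ n)
    = fun N => (x + 1) / 2 * g_psum x N.
  by apply/funext => N; rewrite /g_psum; field.
by apply: cvgM; [exact: cvg_cst|exact: cvg_g_expansion].
Qed.

Lemma expansionE x : 0 < x -> expansion mu x = (g_fun mu x)%:C.
Proof.
move=> x0; apply/esym.
have psum_g : expansion_psum mu ^~ x @ \oo --> ((g_fun mu x)%:C : R[i]^o).
  under eq_fun do rewrite expansion_psumE.
  by apply: cvg_real_complex; exact: cvg_g_expansion.
have psum_e : expansion_psum mu ^~ x @ \oo --> (expansion mu x : R[i]^o).
  by apply: cvgM; [exact: cvg_cst|exact: is_cvg_expansion_term].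
exact: (cvg_unique _ psum_g psum_e).
Qed.

Lemma cvg_uniform_expansion (K : set R) : compact K -> K `<=` [set x | 0 < x] ->
  {uniform K, expansion_psum mu @ \oo --> expansion mu}.
Proof.
move=> cK K0; have [r r01 Kr] := compact_cayley_le cK K0.
(* An entourage of the complex plane has a complex radius, which being positive
   is a real number. *)
move=> /= P /uniform_nbhs[E [entE EP]].
move: entE; rewrite -entourage_from_ballE => -[e /= e0 eE].
have eR : e = (complex.Re e)%:C by rewrite RRe_real // gtr0_real.
have Re0 : 0 < complex.Re e by rewrite -ltcR -eR.
apply: filterS (g_expansion_uniform r01 Re0) => N HN.
apply: EP => x /= Kx; apply: eE => /=.
rewrite -ball_normE /= expansionE; last exact: K0.
by rewrite expansion_psumE -rmorphB normc_real eR ltcR; apply: HN;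
  [exact: K0|exact: Kr].
Qed.

End pollaczek_expansion.

(** The last summand [i = n] of the condition is [|mu_n|^p], and the weight
    [(n + 1)^(p - 1)] is at least 1. *)
Lemma moment_condition_bounded (R : realType) (mu : nat -> R) (p M : R) :
  1 <= p ->
  (forall n : nat,
    (n%:R + 1) `^ (p - 1)
      * \sum_(i < n.+1)
          `| 'C(n, i)%:R * (-1) ^+ (n - i) * fwd_diffn (n - i) mu i | `^ p < M) ->
  forall n, `|mu n| <= 1 + M.
Proof.
move=> p1 mu_bound n.
have mu_p : `|mu n| `^ p <= M.
  apply: le_trans (ltW (mu_bound n)).
  rewrite big_ord_recr /= subnn binn expr0 !mul1r.
  apply: le_trans (_ : 1 * (`|mu n| `^ p) <= _); first by rewrite mul1r.
  apply: ler_pM => //; rewrite ?powR_ge0 //.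
    by rewrite -[leLHS](powRr0 (n%:R + 1)) ler_powR ?subr_ge0 // lerDr.
  by rewrite lerDr sumr_ge0 // => i _; exact: powR_ge0.
have M0 : 0 <= M by apply: le_trans mu_p; exact: powR_ge0.
have [le1|/ltW ge1] := leP `|mu n| 1; first by rewrite (le_trans le1) // lerDl.
apply: le_trans (le1r_powR ge1 p1) _.
by apply: le_trans mu_p _; rewrite lerDr.
Qed.

Theorem theorem5 (R : realType) (mu : nat -> R) (eps p M : R)
  (eps_gt0 : 0 < eps) (p_ge : 2 + eps <= p) (M_gt0 : 0 < M)
  (mu_bound : forall n : nat,
    (n%:R + 1) `^ (p - 1)
      * \sum_(i < n.+1)
          `| 'C(n, i)%:R * (-1) ^+ (n - i) * fwd_diffn (n - i) mu i | `^ p < M) :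
  (forall n : nat, cvgn (series (u_term mu n)))
  /\ (forall x : R, 0 < x ->
        [/\ cvgn (series (g_term mu x)),
            cvgn (series (expansion_term mu x))
          & (g_fun mu x)%:C = expansion mu x])
  /\ (forall K : set R, compact K -> K `<=` [set x | 0 < x] ->
        {uniform K, expansion_psum mu @ \oo --> expansion mu}).
Proof.
have p1 : 1 <= p by lra.
have mu_le := moment_condition_bounded p1 mu_bound.
split=> [n|]; first by apply/cvg_ex; eexists; exact: (cvg_u_term mu_le).
split=> [x x0|K]; last exact: (cvg_uniform_expansion mu_le).
split; first exact: (is_cvg_g_term mu_le).
  exact: (is_cvg_expansion_term mu_le).
by rewrite (expansionE mu_le).
Qed.
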